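(* On each potential flat torsionless submanifold in a pseudo-Euclidean space, there is a structure of a Frobenius algebra (on each tangent space) given, in flat coordinates, by the flat first fundamental form $\eta_{ij}$ and the Weingarten operators $(A_s)^i_j(u)=-\eta^{ik}(\omega_s)_{kj}(u)$: $$\langle e_i,e_j\rangle=\eta_{ij},\qquad e_i\circ e_j=c^k_{ij}(u)e_k,\qquad e_i=\frac{\partial}{\partial u^i},\qquad c^k_{ij}(u)=-(A_i)^k_j(u)=\eta^{ks}(\omega_i)_{sj}(u).$$ In arbitrary local coordinates, this Frobenius structure has the form $$\langle e_i,e_j\rangle=g_{ij},\qquad e_i\circ e_j=c^k_{ij}(u)e_k,\qquad e_i=\frac{\partial}{\partial u^i},\qquad c^k_{ij}(u)=-(A_i)^k_j(u)=g^{ks}(u)(\omega_i)_{sj}(u),$$ where $g^{ij}(u)$ is the contravariant metric inverse to the first fundamental form $g_{ij}(u)$, $g^{is}g_{sj}=\delta^i_j$, and $(\omega_k)_{ij}(u)\,du^i\,du^j$, $1\le k\le N$, are the second fundamental forms.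
   Context: All objects are smooth; repeated upper and lower indices are summed. A pseudo-Euclidean space is a real vector space with a constant nondegenerate symmetric bilinear form $(\cdot,\cdot)$ of arbitrary signature. Submanifolds $r(u^1,\dots,u^N)$ are totally nonisotropic: the first fundamental form $g_{ij}=(r_{u^i},r_{u^j})$ is nondegenerate; flat means $g_{ij}$ is a flat metric; in flat coordinates $g_{ij}=\eta_{ij}$ is constant, with inverse $\eta^{ij}$. Normal bases $n_\alpha$ with constant nondegenerate Gram matrix are used; second fundamental forms: $(\omega_\alpha)_{ij}=(n_\alpha,r_{u^iu^j})$; torsionless means that for a suitable such basis (the one used) the torsion forms $(n_{\alpha,u^i},n_\beta)\,du^i$ all vanish. A flat torsionless $N$-dimensional submanifold in a $2N$-dimensional pseudo-Euclidean space is called potential if there always locally exists a function $\Phi(u)$ such that the second fundamental forms locally have the form $(\omega_i)_{jk}\,du^j\,du^k=(\nabla_i\nabla_j\nabla_k\Phi)\,du^j\,du^k$, $1\le i\le N$, where $\nabla$ is the Levi-Civita covariant differentiation of $g_{ij}$. A Frobenius algebra is a finite-dimensional algebra equipped with a nondegenerate bilinear form $f$ that is invariant, $f(a\circ b,c)=f(a,b\circ c)$; the Frobenius algebras considered in this setting are commutative and associative with symmetric form. *)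

(* Defs.v *)
From HB Require Import structures.
From mathcomp Require Import all_boot all_order all_algebra.
From mathcomp Require Import all_classical all_reals all_analysis.

Set Implicit Arguments.
Unset Strict Implicit.
Unset Printing Implicit Defensive.

Import Order.TTheory GRing.Theory Num.Theory.
Import numFieldNormedType.Exports.

Local Open Scope classical_set_scope.
Local Open Scope ring_scope.

(* The unit is not part of the structure. *)
Definition frobenius_algebra (K : fieldType) (A : vectType K)
    (mul : A -> A -> A) (f : A -> A -> K) : Prop :=
  [/\ [/\ forall a x y z, mul (a *: x + y) z = a *: mul x z + mul y z,
          forall a x y z, mul z (a *: x + y) = a *: mul z x + mul z y,
          commutative mul & associative mul],
      [/\ forall a x y z, f (a *: x + y) z = a * f x z + f y z,
          forall x y, f x y = f y x &
          forall x, (forall y, f x y = 0) -> x = 0] &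
      forall x y z, f (mul x y) z = f x (mul y z)].

Definition coord_vec (R : realType) (N : nat) (i : 'I_N) : 'rV[R]_N :=
  delta_mx 0 i.

Definition partial (R : realType) (N : nat) (W : normedModType R) (i : 'I_N)
    (f : 'rV[R]_N -> W) (u : 'rV[R]_N) : W :=
  'D_(coord_vec R i) f u.

(* C^oo on the open set U: all iterated partial derivatives are (Frechet)
   differentiable, hence continuous, at every point of U. *)
Definition smooth_on (R : realType) (N : nat) (W : normedModType R)
    (U : set 'rV[R]_N) (f : 'rV[R]_N -> W) : Prop :=
  forall (s : seq 'I_N) (u : 'rV[R]_N), U u ->
    differentiable (foldr (fun i h => partial i h) f s) u.

Definition pseudo_euclidean (R : realType) (M : nat) (G : 'M[R]_M) : Prop :=
  G^T = G /\ G \in unitmx.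

Definition dot (R : realType) (M : nat) (G : 'M[R]_M) (x y : 'rV[R]_M) : R :=
  (x *m G *m y^T) 0 0.

(* (dr X, dr Y): the first fundamental form on the tangent space at u, which is
   identified with 'rV[R]_N through the frame d/du^i = coord_vec R i. *)
Definition first_form (R : realType) (N M : nat) (G : 'M[R]_M)
    (r : 'rV[R]_N -> 'rV[R]_M) (u X Y : 'rV[R]_N) : R :=
  dot G ('D_X r u) ('D_Y r u).

Definition metric (R : realType) (N M : nat) (G : 'M[R]_M)
    (r : 'rV[R]_N -> 'rV[R]_M) (u : 'rV[R]_N) : 'M[R]_N :=
  \matrix_(i, j) dot G (partial i r u) (partial j r u).

Definition second_form (R : realType) (N M : nat) (G : 'M[R]_M)
    (r : 'rV[R]_N -> 'rV[R]_M) (nu : 'rV[R]_N -> 'rV[R]_M)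
    (u : 'rV[R]_N) : 'M[R]_N :=
  \matrix_(i, j) dot G (nu u) (partial j (partial i r) u).

(* A^i_j = - g^{ik} om_{kj}. *)
Definition weingarten (R : realType) (N : nat) (g om : 'M[R]_N) : 'M[R]_N :=
  - (invmx g *m om).

(* Gamma^k_{ij}. *)
Definition christoffel (R : realType) (N : nat) (g : 'rV[R]_N -> 'M[R]_N)
    (k i j : 'I_N) (u : 'rV[R]_N) : R :=
  2^-1 * \sum_s invmx (g u) k s *
    (partial i (fun v => g v s j : R) u + partial j (fun v => g v i s : R) u
     - partial s (fun v => g v i j : R) u).

(* R^l_{kij}. *)
Definition riemann (R : realType) (N : nat) (g : 'rV[R]_N -> 'M[R]_N)
    (l k i j : 'I_N) (u : 'rV[R]_N) : R :=
  partial i (christoffel g l j k) u - partial j (christoffel g l i k) u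
  + \sum_s (christoffel g l i s u * christoffel g s j k u
            - christoffel g l j s u * christoffel g s i k u).

Definition flat_metric_on (R : realType) (N : nat) (U : set 'rV[R]_N)
    (g : 'rV[R]_N -> 'M[R]_N) : Prop :=
  forall u, U u -> forall l k i j, riemann g l k i j u = 0.

(* nabla_i xi_j. *)
Definition nabla1 (R : realType) (N : nat) (g : 'rV[R]_N -> 'M[R]_N)
    (xi : 'I_N -> 'rV[R]_N -> R) (i j : 'I_N) (u : 'rV[R]_N) : R :=
  partial i (xi j) u - \sum_s christoffel g s i j u * xi s u.

(* nabla_i T_{jk}. *)
Definition nabla2 (R : realType) (N : nat) (g : 'rV[R]_N -> 'M[R]_N)
    (T : 'I_N -> 'I_N -> 'rV[R]_N -> R) (i j k : 'I_N) (u : 'rV[R]_N) : R :=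
  partial i (T j k) u
  - \sum_s (christoffel g s i j u * T s k u + christoffel g s i k u * T j s u).

(* nabla_i nabla_j nabla_k Phi. *)
Definition third_covariant_derivative (R : realType) (N : nat)
    (g : 'rV[R]_N -> 'M[R]_N) (Phi : 'rV[R]_N -> R)
    (i j k : 'I_N) (u : 'rV[R]_N) : R :=
  nabla2 g (nabla1 g (fun l v => partial l Phi v)) i j k u.

(* Nondegeneracy of the metric makes r an immersion; no injectivity is
   required. *)
Definition nonisotropic_submanifold (R : realType) (N M : nat) (G : 'M[R]_M)
    (U : set 'rV[R]_N) (r : 'rV[R]_N -> 'rV[R]_M) : Prop :=
  [/\ open U, smooth_on U r & forall u, U u -> metric G r u \in unitmx].

(* Nondegeneracy of the Gram matrix mu makes the n i linearly independent, so
   that they form a basis of the N-dimensional normal space. *)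
Definition constant_gram_normal_basis (R : realType) (N : nat)
    (G : 'M[R]_(N + N)) (U : set 'rV[R]_N) (r : 'rV[R]_N -> 'rV[R]_(N + N))
    (n : 'I_N -> 'rV[R]_N -> 'rV[R]_(N + N)) : Prop :=
  [/\ forall i, smooth_on U (n i),
      forall u, U u -> forall i j, dot G (n i u) (partial j r u) = 0 &
      exists2 mu : 'M[R]_N, mu \in unitmx &
        forall u, U u -> forall i j, dot G (n i u) (n j u) = mu i j].

Definition torsionless (R : realType) (N M : nat) (G : 'M[R]_M)
    (U : set 'rV[R]_N) (n : 'I_N -> 'rV[R]_N -> 'rV[R]_M) : Prop :=
  forall u, U u -> forall (a b i : 'I_N),
    dot G (partial i (n a) u) (n b u) = 0.

(* The normal basis n is the one whose torsion forms vanish and to which the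
   second fundamental forms refer; n i is numbered by the coordinate u^i. *)
Definition potential_submanifold (R : realType) (N : nat)
    (G : 'M[R]_(N + N)) (U : set 'rV[R]_N) (r : 'rV[R]_N -> 'rV[R]_(N + N))
    (n : 'I_N -> 'rV[R]_N -> 'rV[R]_(N + N)) : Prop :=
  [/\ nonisotropic_submanifold G U r,
      flat_metric_on U (metric G r),
      constant_gram_normal_basis G U r n,
      torsionless G U n &
      forall u0, U u0 -> exists (W : set 'rV[R]_N) (Phi : 'rV[R]_N -> R),
        [/\ open W, W u0, W `<=` U, smooth_on W Phi &
            forall u, W u -> forall i j k,
              second_form G r (n i) u j k
              = third_covariant_derivative (metric G r) Phi i j k u]].

(* v |-> u = phi v identifies V with an open subset of U, on which the
   coordinates of v are new local coordinates. *)
Definition coordinate_change (R : realType) (N : nat)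
    (V U : set 'rV[R]_N) (phi : 'rV[R]_N -> 'rV[R]_N) : Prop :=
  [/\ open V, smooth_on V phi, phi @` V `<=` U, open (phi @` V) &
      exists2 psi : 'rV[R]_N -> 'rV[R]_N, smooth_on (phi @` V) psi &
        forall v, V v -> psi (phi v) = v].

(* The basis vector d/dv^i at the point phi v, in the coordinates u. *)
Definition new_frame (R : realType) (N : nat) (phi : 'rV[R]_N -> 'rV[R]_N)
    (v : 'rV[R]_N) (i : 'I_N) : 'rV[R]_N :=
  partial i phi v.

(* The index numbering the normals is a tensor index:
   n_i becomes (d u^k / d v^i) n_k, as forced by om_i = nabla_i nabla nabla Phi. *)
Definition new_normal (R : realType) (N M : nat)
    (phi : 'rV[R]_N -> 'rV[R]_N) (n : 'I_N -> 'rV[R]_N -> 'rV[R]_M)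
    (i : 'I_N) (v : 'rV[R]_N) : 'rV[R]_M :=
  \sum_k (partial i phi v) 0 k *: n k (phi v).

(* <e_i, e_j> = g_{ij} and e_i o e_j = c^k_{ij} e_k with
   c^k_{ij} = - (A_i)^k_j = g^{ks} (om_i)_{sj}. *)
Definition frobenius_structure_form (R : realType) (N : nat)
    (mul : 'rV[R]_N -> 'rV[R]_N -> 'rV[R]_N) (f : 'rV[R]_N -> 'rV[R]_N -> R)
    (e : 'I_N -> 'rV[R]_N) (g : 'M[R]_N) (om : 'I_N -> 'M[R]_N) : Prop :=
  exists c : 'I_N -> 'I_N -> 'I_N -> R,
    [/\ forall i j, f (e i) (e j) = g i j,
        forall i j, mul (e i) (e j) = \sum_k c k i j *: e k,
        forall k i j, c k i j = - weingarten g (om i) k j &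
        forall k i j, c k i j = \sum_s invmx g k s * om i s j].

(* Main.v *)
(* In a torsionless normal frame the Ricci equation says that the Weingarten
   operators commute, and the Ricci identity of the flat connection makes
   om_{ijk} = nabla_i nabla_j nabla_k Phi totally symmetric.  Total symmetry
   gives commutativity of x o y = g^{-1} om(x, y, .) and invariance of g, and
   then commuting multiplication operators give associativity.  Tensoriality of
   g and om transports the structure to arbitrary coordinates: the Hessian of
   the coordinate change contributes only tangent vectors, which the normals
   annihilate. *)
Require Import Defs.
From HB Require Import structures.
From mathcomp Require Import all_boot all_order all_algebra.
From mathcomp Require Import all_classical all_reals all_analysis.
From mathcomp Require Import ring lra.
Import Order.TTheory GRing.Theory Num.Theory.
Import numFieldNormedType.Exports.
Local Open Scope classical_set_scope.
Local Open Scope ring_scope.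

(** * Symmetry of second derivatives *)

(** The difference quotients on the two sides are the same function of [h]. This puts a directional
    derivative within reach of the one-variable mean value theorem. *)
Lemma is_derive_line {R : realType} {V : normedModType R} (f : V -> R)
    (a w : V) (s df : R) :
  is_derive (s *: a + w) a f df ->
  is_derive s 1 (fun t => f (t *: a + w)) df.
Proof.
move=> [fa <-].
have E : (fun h : R => h^-1 *: (((fun t => f (t *: a + w)) \o shift s) (h *: 1)
    - f (s *: a + w))) =
   (fun h => h^-1 *: ((f \o shift (s *: a + w)) (h *: a) - f (s *: a + w))).
  by apply/funext => h /=; rewrite [h%:A]mulr1 scalerDl addrA.
split; first by rewrite /derivable E.
by rewrite /derive E.
Qed.

(** The mean value theorem along [a] turns the second difference into [t] times an increment of [F],
    and the first-order expansion of [F] at [u] evaluates that increment. Differentiability of [F]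
    at the single point [u] replaces continuity of second derivatives. *)
Lemma second_difference_approx {R : realType} {V : normedModType R}
    (f F : V -> R) (u a b : V) :
  (\forall v \near u, is_derive v a f (F v)) -> differentiable F u ->
  forall e : R, 0 < e -> \forall t \near (0 : R)^'+,
    `|f (t *: a + (t *: b + u)) - f (t *: b + u) - f (t *: a + u) + f u
      - t ^+ 2 * 'D_b F u| <= e * t ^+ 2.
Proof.
move=> df dF e e0; rewrite deriveE//.
set L : {linear V -> R} := 'd F u.
(* [F] is expanded at the displacements [c *: a + t *: b] and [c *: a], whose norms add up to at
   most [t * (2 * |a| + |b|)]. The summand 1 makes [C] positive. *)
set C := 2 * `|a| + `|b| + 1.
have C0 : 0 < C by rewrite /C ltr_pwDr// addr_ge0// mulr_ge0.
have eC : 0 < e / C by rewrite divr_gt0.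
have est : \forall h \near (0 : V),
    `|F (h + u) - (F u + L h)| <= e / C * `|h|.
  by have /diff_locallyP[_ /eqaddoP /(_ (e / C) eC)] := dF.
have df' : \forall h \near (0 : V), is_derive (h + u) a f (F (h + u)).
  by move: df; rewrite (near_shift 0) subr0.
have /nbhs_ballP[d /= d0 Hd] : nbhs (0 : V) (fun h =>
    `|F (h + u) - (F u + L h)| <= e / C * `|h|
    /\ is_derive (h + u) a f (F (h + u))).
  exact: filterI est df'.
have HB h : `|h| < d -> `|F (h + u) - (F u + L h)| <= e / C * `|h|
    /\ is_derive (h + u) a f (F (h + u)).
  by move=> hd; apply: Hd; rewrite -ball_normE/= sub0r normrN.
near=> t.
have t0 : 0 < t by near: t; exact: nbhs_right_gt.
have td : t < d / C by near: t; apply: nbhs_right_lt; rewrite divr_gt0.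
have tC : t * C < d by rewrite -ltr_pdivlMr.
have na s : 0 <= s <= t -> `|s *: a| <= t * `|a|.
  by move=> /andP[s0 st]; rewrite normrZ ger0_norm// ler_wpM2r.
have nb : `|t *: b| = t * `|b| by rewrite normrZ gtr0_norm.
have nab s : 0 <= s <= t -> `|s *: a + t *: b| <= t * `|a| + t * `|b|.
  by move=> /na st; rewrite (le_trans (ler_normD _ _))// nb lerD2r.
have aux1 : t * `|a| < d.
  apply: le_lt_trans tC; rewrite ler_pM2l// /C.
  by have := normr_ge0 a; have := normr_ge0 b; lra.
have aux2 : t * `|a| + t * `|b| < d.
  apply: le_lt_trans tC; rewrite -mulrDr ler_pM2l// /C.
  by have := normr_ge0 a; have := normr_ge0 b; lra.
pose p s := f (s *: a + (t *: b + u)) - f (s *: a + u).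
have dp s : s \in `[0, t] ->
    is_derive s 1 p (F (s *: a + (t *: b + u)) - F (s *: a + u)).
  rewrite in_itv/= => st; apply: is_deriveB; apply: is_derive_line.
    by rewrite addrA; apply: (HB _ _).2; exact: le_lt_trans (nab s st) aux2.
  by apply: (HB _ _).2; exact: le_lt_trans (na s st) aux1.
pose dp' s := F (s *: a + (t *: b + u)) - F (s *: a + u).
have H1 x : x \in `]0, t[%R -> is_derive x 1 p (dp' x).
  by move=> xt; apply: dp; apply: subset_itv_oo_cc xt.
have H2 : {within `[0, t], continuous p}.
  by apply: derivable_within_continuous => s /dp [].
(* [p t - p 0] is the second difference, so it equals [t] times [dp' c] for some intermediate
   [c]. *)
have [c + E] := @MVT_segment R p dp' 0 t (ltW t0) H1 H2.
rewrite in_itv/= => ct; move: E; rewrite /p /dp' !scale0r !add0r subr0 => E.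
have -> : f (t *: a + (t *: b + u)) - f (t *: b + u) - f (t *: a + u) + f u
   = (F (c *: a + (t *: b + u)) - F (c *: a + u)) * t by rewrite -E; ring.
have [/= h1 _] := HB _ (le_lt_trans (nab c ct) aux2).
have [/= h2 _] := HB _ (le_lt_trans (na c ct) aux1).
rewrite -addrA in h1.
set X := F (_ + (_ + _)) in h1 *; set Y := F (c *: a + u) in h2 *.
have LE : L (c *: a + t *: b) = L (c *: a) + t * L b.
  by rewrite linearD; congr (_ + _); rewrite linearZ.
(* [F u] and [L (c *: a)] cancel, so the unknown [c] survives only in the two remainders. *)
have -> : (X - Y) * t - t ^+ 2 * L b =
    t * ((X - (F u + L (c *: a + t *: b))) - (Y - (F u + L (c *: a)))).
  by rewrite LE; ring.
rewrite normrM gtr0_norm// expr2 mulrCA ler_pM2l//.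
apply: le_trans (ler_normB _ _) _.
apply: le_trans (lerD h1 h2) _; rewrite -mulrDr.
apply: (@le_trans _ _ (e / C * (C * t))); last by rewrite mulrA divfK ?gt_eqF.
rewrite ler_pM2l// (le_trans (lerD (nab c ct) (na c ct)))// /C.
by have := normr_ge0 a; have := normr_ge0 b; nra.
Unshelve. all: by end_near. Qed.

Lemma le_norm_sub_of_common_approx {R : realType} (S T t x y e : R) :
  0 < t -> S = T -> `|S - t * x| <= e / 2 * t -> `|T - t * y| <= e / 2 * t ->
  `|x - y| <= e.
Proof.
move=> t0 <-; rewrite -(ler_pM2r t0 `|x - y|).
rewrite -[X in `|x - y| * X <= _](gtr0_norm t0) -normrM.
by rewrite !ler_norml => /andP[? ?] /andP[? ?]; apply/andP; split; lra.
Qed.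

(* Young's form of the symmetry of second derivatives: both iterated
   derivatives are limits of the same second difference quotient. *)
Lemma derive_comm {R : realType} {V : normedModType R} (f F G : V -> R)
    (u a b : V) :
  (\forall v \near u, is_derive v a f (F v)) ->
  (\forall v \near u, is_derive v b f (G v)) ->
  differentiable F u -> differentiable G u -> 'D_b F u = 'D_a G u.
Proof.
move=> fF fG dF dG; apply/eqP; rewrite -subr_eq0 -normr_le0; apply/ler_addgt0Pl.
move=> e e0; rewrite addr0.
have e2 : 0 < e / 2 by rewrite divr_gt0.
have A1 := second_difference_approx f F u a b fF dF _ e2.
have A2 := second_difference_approx f G u b a fG dG _ e2.
have [t [[h1 h2] t0]] := filter_ex (filterI (filterI A1 A2) (nbhs_right_gt 0)).
(* The second difference is symmetric in [a] and [b], hence both estimates concern the same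
   number. *)
apply: (@le_norm_sub_of_common_approx R _ _ (t ^+ 2) _ _ e _ _ h1 h2).
  by rewrite exprn_gt0.
by rewrite [t *: b + (_ + _)]addrCA; ring.
Qed.

(** * Calculus of smooth maps *)

Lemma is_derive_fsum {R : realType} {V : normedModType R} {n : nat}
    (F : 'I_n -> V -> R) (dF : 'I_n -> R) (x h : V) :
  (forall i, is_derive x h (F i) (dF i)) ->
  is_derive x h (fun y => \sum_i F i y) (\sum_i dF i).
Proof.
move=> H; have -> : (fun y => \sum_i F i y) = \sum_i F i.
  by apply/funext => y; rewrite fct_sumE.
exact: is_derive_sum.
Qed.

Lemma is_derive_mul {R : realType} {V : normedModType R} (f g : V -> R)
    (df dg : R) (x h : V) :
  is_derive x h f df -> is_derive x h g dg ->
  is_derive x h (fun y => f y * g y) (df * g x + f x * dg).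
Proof.
move=> Hf Hg; apply: is_derive_eq (is_deriveM Hf Hg) _.
by rewrite addrC mulrC.
Qed.

Lemma is_derive_coord {R : realType} {V : normedModType R} {m n : nat}
    (f : V -> 'M[R]_(m, n)) (df : 'M[R]_(m, n)) (x h : V) (i : 'I_m) (j : 'I_n) :
  is_derive x h f df -> is_derive x h (fun y => f y i j) (df i j).
Proof.
move=> [fx <-]; split; first exact: (derivable_mxP _ _ _).1 fx i j.
by rewrite derive_mx// mxE.
Qed.

Lemma is_derive_diff {R : realType} {V W : normedModType R} (f : V -> W)
    (x h : V) : differentiable f x -> is_derive x h f ('D_h f x).
Proof. by move=> df; apply/derivableP/diff_derivable. Qed.

Lemma derivable_fsum {R : realType} {V : normedModType R} {I : Type}
    (r : seq I) (F : I -> V -> R) (x h : V) :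
  (forall i, derivable (F i) x h) -> derivable (fun y => \sum_(i <- r) F i y) x h.
Proof.
move=> H; elim: r => [|i r IH].
  by under eq_fun do rewrite big_nil; exact: derivable_cst.
by under eq_fun do rewrite big_cons; exact: derivableD.
Qed.

Lemma derivable_fprod {R : realType} {V : normedModType R} {I : Type}
    (r : seq I) (F : I -> V -> R) (x h : V) :
  (forall i, derivable (F i) x h) -> derivable (fun y => \prod_(i <- r) F i y) x h.
Proof.
move=> H; elim: r => [|i r IH].
  by under eq_fun do rewrite big_nil; exact: derivable_cst.
by under eq_fun do rewrite big_cons; exact: derivableM.
Qed.

Lemma derivable_det {R : realType} {V : normedModType R} {n : nat}
    (A : V -> 'M[R]_n) (x h : V) :
  (forall i j, derivable (fun y => A y i j) x h) ->
  derivable (fun y => \det (A y)) x h.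
Proof.
move=> H; rewrite /determinant; apply: derivable_fsum => s.
apply: derivableM; first exact: derivable_cst.
exact: derivable_fprod.
Qed.

(** Cramer's rule: the entries are cofactors over the determinant. Invertibility on a neighbourhood
    matters, since [invmx] takes a default value at singular matrices. *)
Lemma derivable_invmx {R : realType} {V : normedModType R} {n : nat}
    (A : V -> 'M[R]_n) (x h : V) (i j : 'I_n) :
  (\forall y \near x, A y \in unitmx) ->
  (forall i j, derivable (fun y => A y i j) x h) ->
  derivable (fun y => invmx (A y) i j) x h.
Proof.
move=> Aunit H.
apply: (@near_eq_derivable _ _ _ (fun y => (\det (A y))^-1 * cofactor (A y) j i)).
  near=> y; rewrite /invmx ifT; last by near: y.
  by rewrite !mxE.
apply: derivableM.
  apply: derivableV; last exact: derivable_det.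
  by have := nbhs_singleton Aunit; rewrite unitmxE unitfE.
apply: derivableM; first exact: derivable_cst.
apply: derivable_det => k l.
by under eq_fun do rewrite !mxE; exact: H.
Unshelve. all: by end_near. Qed.

(** * The bilinear form of a Gram matrix *)

Lemma dotE {R : realType} {M : nat} (G : 'M[R]_M) (x y : 'rV[R]_M) :
  dot G x y = \sum_k (\sum_l x 0 l * G l k) * y 0 k.
Proof. by rewrite /dot mxE; apply: eq_bigr => k _; rewrite !mxE. Qed.

Lemma dotC {R : realType} {M : nat} (G : 'M[R]_M) (x y : 'rV[R]_M) :
  G^T = G -> dot G x y = dot G y x.
Proof.
move=> GT; rewrite /dot -[LHS]/((x *m G *m y^T) 0 0).
rewrite -[x *m G *m y^T]trmxK mxE !trmx_mul trmxK GT mulmxA.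
by [].
Qed.

Lemma dot_suml {R : realType} {M : nat} (G : 'M[R]_M) {n : nat}
    (a : 'I_n -> R) (x : 'I_n -> 'rV[R]_M) (y : 'rV[R]_M) :
  dot G (\sum_i a i *: x i) y = \sum_i a i * dot G (x i) y.
Proof.
rewrite /dot !mulmx_suml summxE; apply: eq_bigr => i _.
by rewrite -!scalemxAl mxE.
Qed.

Lemma dot_sumr {R : realType} {M : nat} (G : 'M[R]_M) {n : nat}
    (a : 'I_n -> R) (x : 'I_n -> 'rV[R]_M) (y : 'rV[R]_M) :
  dot G y (\sum_i a i *: x i) = \sum_i a i * dot G y (x i).
Proof.
rewrite /dot linear_sum mulmx_sumr summxE; apply: eq_bigr => i _.
by rewrite linearZ -scalemxAr mxE.
Qed.

Lemma is_derive_dot {R : realType} {V : normedModType R} {M : nat}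
    (G : 'M[R]_M) (f g : V -> 'rV[R]_M) (df dg : 'rV[R]_M) (x h : V) :
  is_derive x h f df -> is_derive x h g dg ->
  is_derive x h (fun y => dot G (f y) (g y)) (dot G df (g x) + dot G (f x) dg).
Proof.
move=> Hf Hg; under eq_fun do rewrite dotE.
rewrite !dotE -big_split/=; apply: is_derive_fsum => k.
apply: is_derive_mul; last exact: is_derive_coord.
apply: is_derive_fsum => l.
apply: is_derive_eq (is_derive_mul _ _ _ _ _ _ (is_derive_coord f df x h 0 l Hf)
  (is_derive_cst (G l k) x h)) _.
by rewrite mulr0 addr0.
Qed.

(** * Smooth maps on an open set *)

Lemma smooth_on_differentiable {R : realType} {N : nat} {W : normedModType R}
    (U : set 'rV[R]_N) (f : 'rV[R]_N -> W) (u : 'rV[R]_N) :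
  smooth_on U f -> U u -> differentiable f u.
Proof. by move=> sf; exact: (sf [::]). Qed.

Lemma smooth_on_partial {R : realType} {N : nat} {W : normedModType R}
    (U : set 'rV[R]_N) (f : 'rV[R]_N -> W) (i : 'I_N) :
  smooth_on U f -> smooth_on U (partial i f).
Proof.
(* [foldr] applies the last entry of the list first, so the innermost derivative is appended at the
   end. *)
by move=> sf s u Uu; have := sf (rcons s i) u Uu; rewrite foldr_rcons.
Qed.

Lemma smooth_on_is_derive {R : realType} {N : nat} {W : normedModType R}
    (U : set 'rV[R]_N) (f : 'rV[R]_N -> W) (u h : 'rV[R]_N) :
  smooth_on U f -> U u -> is_derive u h f ('D_h f u).
Proof.
by move=> sf Uu; apply: is_derive_diff; exact: smooth_on_differentiable sf Uu.
Qed.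

Lemma partial_comm {R : realType} {N : nat} (U : set 'rV[R]_N)
    (f : 'rV[R]_N -> R) (i j : 'I_N) (u : 'rV[R]_N) :
  open U -> smooth_on U f -> U u ->
  partial i (partial j f) u = partial j (partial i f) u.
Proof.
move=> oU sf Uu; apply: (derive_comm f).
- by apply: filterS (open_nbhs_nbhs (conj oU Uu)) => v; exact: smooth_on_is_derive.
- by apply: filterS (open_nbhs_nbhs (conj oU Uu)) => v; exact: smooth_on_is_derive.
- by apply: smooth_on_differentiable Uu; exact: smooth_on_partial.
- by apply: smooth_on_differentiable Uu; exact: smooth_on_partial.
Qed.

Lemma partial_comm_row {R : realType} {N M : nat} (U : set 'rV[R]_N)
    (f : 'rV[R]_N -> 'rV[R]_M) (i j : 'I_N) (u : 'rV[R]_N) :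
  open U -> smooth_on U f -> U u ->
  partial i (partial j f) u = partial j (partial i f) u.
Proof.
move=> oU sf Uu; apply/rowP => k.
have E a b : partial b (partial a f) u 0 k
    = 'D_(coord_vec R b) (fun v => partial a f v 0 k) u.
  apply/esym/derive_val; apply: is_derive_coord; apply: smooth_on_is_derive Uu.
  exact: smooth_on_partial.
have D a : \forall v \near u,
    is_derive v (coord_vec R a) (fun v => f v 0 k) (partial a f v 0 k).
  apply: filterS (open_nbhs_nbhs (conj oU Uu)) => v Uv; apply: is_derive_coord.
  exact: smooth_on_is_derive sf Uv.
have dD a : differentiable (fun v => partial a f v 0 k) u.
  apply: (@differentiable_comp _ _ _ _ (partial a f) (fun A : 'rV[R]_M => A 0 k)).
    by apply: smooth_on_differentiable Uu; exact: smooth_on_partial.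
  exact: differentiable_coord.
apply: etrans (E j i) _; apply: etrans _ (esym (E i j)).
exact: (derive_comm (fun v => f v 0 k)).
Qed.

(** * Ricci identity and Ricci equation *)

(** Serves to differentiate the orthogonality of normals to tangents and the vanishing of the
    torsion forms. *)
Lemma is_derive_constant_on {R : realType} {V : normedModType R} (U : set V)
    (f : V -> R) (c df : R) (u h : V) :
  open U -> U u -> (forall v, U v -> f v = c) -> is_derive u h f df -> df = 0.
Proof.
move=> oU Uu fc [_ <-].
rewrite (@near_eq_derive _ _ _ f (cst c)) ?derive_cst//.
by apply: filterS (open_nbhs_nbhs (conj oU Uu)) => v /fc.
Qed.

Lemma metricC {R : realType} {N M : nat} (G : 'M[R]_M)
    (r : 'rV[R]_N -> 'rV[R]_M) (u : 'rV[R]_N) (i j : 'I_N) :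
  G^T = G -> metric G r u i j = metric G r u j i.
Proof. by move=> GT; rewrite !mxE dotC. Qed.

Lemma christoffelC {R : realType} {N : nat} (g : 'rV[R]_N -> 'M[R]_N)
    (k i j : 'I_N) (u : 'rV[R]_N) :
  (forall v i j, g v i j = g v j i) ->
  christoffel g k i j u = christoffel g k j i u.
Proof.
move=> gC; have E a b : (fun v => g v a b : R) = (fun v => g v b a).
  by apply/funext => v.
rewrite /christoffel; congr (_ * _); apply: eq_bigr => s _; congr (_ * _).
by rewrite (E i s) (E j s) (E i j); congr (_ - _); rewrite addrC.
Qed.

Lemma is_derive_metric {R : realType} {N M : nat} (G : 'M[R]_M)
    (U : set 'rV[R]_N) (r : 'rV[R]_N -> 'rV[R]_M) (u h : 'rV[R]_N)
    (i j : 'I_N) :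
  smooth_on U r -> U u ->
  is_derive u h (fun v => metric G r v i j)
    (dot G ('D_h (partial i r) u) (partial j r u)
     + dot G (partial i r u) ('D_h (partial j r) u)).
Proof.
move=> sr Uu; under eq_fun do rewrite mxE.
by apply: is_derive_dot; apply: smooth_on_is_derive Uu; exact: smooth_on_partial.
Qed.

(** Near [u] the derivative of the metric is given by the product rule in terms of derivatives of
    [r], and that expression can be differentiated again. *)
Lemma derivable_partial_metric {R : realType} {N M : nat} (G : 'M[R]_M)
    (U : set 'rV[R]_N) (r : 'rV[R]_N -> 'rV[R]_M) (u h : 'rV[R]_N)
    (i j k : 'I_N) :
  open U -> smooth_on U r -> U u ->
  derivable (partial k (fun v => metric G r v i j : R)) u h.
Proof.
move=> oU sr Uu.
apply: (@near_eq_derivable _ _ _ (fun v =>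
  dot G (partial k (partial i r) v) (partial j r v)
  + dot G (partial i r v) (partial k (partial j r) v))).
  apply: filterS (open_nbhs_nbhs (conj oU Uu)) => v Uv.
  by apply/esym/derive_val; exact: is_derive_metric sr Uv.
by apply: derivableD; apply: ex_derive; apply: is_derive_dot;
  apply: smooth_on_is_derive Uu; do ?exact: smooth_on_partial;
  do 2!apply: smooth_on_partial.
Qed.

Lemma derivable_christoffel {R : realType} {N M : nat} (G : 'M[R]_M)
    (U : set 'rV[R]_N) (r : 'rV[R]_N -> 'rV[R]_M) (u h : 'rV[R]_N)
    (k i j : 'I_N) :
  nonisotropic_submanifold G U r -> U u ->
  derivable (christoffel (metric G r) k i j) u h.
Proof.
move=> [oU sr gU] Uu; rewrite /christoffel.
apply: derivableM; first exact: derivable_cst.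
apply: derivable_fsum => s; apply: derivableM.
  apply: derivable_invmx.
    by apply: filterS (open_nbhs_nbhs (conj oU Uu)) => v /gU.
  by move=> a b; apply: ex_derive; exact: is_derive_metric sr Uu.
by apply: derivableB; [apply: derivableD|]; exact: derivable_partial_metric sr Uu.
Qed.

(** After antisymmetrization the second partials of [xi] cancel, the term with the Christoffel
    symbol in [i], [j] drops by symmetry of the connection, and the first derivatives of [xi] cancel
    crosswise; only curvature remains. *)
Lemma ricci_identity {R : realType} {N : nat} (g : 'rV[R]_N -> 'M[R]_N)
    (xi : 'I_N -> 'rV[R]_N -> R) (i j k : 'I_N) (u : 'rV[R]_N) :
  (forall l a b, christoffel g l a b u = christoffel g l b a u) ->
  (forall l a b h, derivable (christoffel g l a b) u h) ->
  (forall a h, derivable (xi a) u h) ->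
  (forall a b h, derivable (partial a (xi b)) u h) ->
  partial i (partial j (xi k)) u = partial j (partial i (xi k)) u ->
  nabla2 g (nabla1 g xi) i j k u - nabla2 g (nabla1 g xi) j i k u
  = - \sum_l riemann g l k i j u * xi l u.
Proof.
move=> GC dG dxi ddxi xiC.
have E a b : partial a (nabla1 g xi b k) u = partial a (partial b (xi k)) u
    - \sum_s (partial a (christoffel g s b k) u * xi s u
              + christoffel g s b k u * partial a (xi s) u).
  apply: derive_val; apply: is_deriveB; first exact: derivableP.
  by apply: is_derive_fsum => s; apply: is_derive_mul; exact: derivableP.
(* The part quadratic in the Christoffel symbols, which supplies the quadratic terms of the
   curvature. *)
pose Q a b := \sum_l (\sum_s christoffel g l b s u * christoffel g s a k u) * xi l u.
have HQ a b : \sum_s christoffel g s a k u * nabla1 g xi b s u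
    = \sum_s christoffel g s a k u * partial b (xi s) u - Q a b.
  rewrite /Q; under [X in _ - X]eq_bigr do rewrite mulr_suml.
  rewrite exchange_big -sumrB; apply: eq_bigr => s _.
  rewrite /nabla1 mulrBr; congr (_ - _); rewrite mulr_sumr.
  by apply: eq_bigr => l _; ring.
have HR : \sum_l riemann g l k i j u * xi l u
    = \sum_s partial i (christoffel g s j k) u * xi s u
      - \sum_s partial j (christoffel g s i k) u * xi s u + Q j i - Q i j.
  rewrite /Q -sumrB -big_split -sumrB; apply: eq_bigr => l _ /=.
  by rewrite /riemann sumrB mulrDl !mulrBl addrA.
have HT : \sum_s christoffel g s j i u * nabla1 g xi s k u
  = \sum_s christoffel g s i j u * nabla1 g xi s k u.
  by apply: eq_bigr => s _; rewrite GC.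
(* [D] is the second partial of [xi]; [A], [A'] contain derivatives of Christoffel symbols; [B], [C]
   contain first derivatives of [xi]; [T] is the symmetric term; [q], [q'] are values of [Q]. *)
have cancel (D A B A' T C q q' : R) :
  D - (A + B) - (T + (C - q)) - (D - (A' + C) - (T + (B - q')))
  = - (A - A' + q' - q) by ring.
rewrite HR /nabla2 (E i j) (E j i) xiC !big_split/= (HQ i j) (HQ j i) HT.
exact: cancel.
Qed.

(** The Ricci identity for the covector [d Phi], with zero curvature. *)
Lemma flat_third_covariant_derivativeC {R : realType} {N M : nat}
    (G : 'M[R]_M) (U W : set 'rV[R]_N) (r : 'rV[R]_N -> 'rV[R]_M)
    (Phi : 'rV[R]_N -> R) (u : 'rV[R]_N) (i j k : 'I_N) :
  G^T = G -> nonisotropic_submanifold G U r -> flat_metric_on U (metric G r) ->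
  open W -> smooth_on W Phi -> W u -> U u ->
  third_covariant_derivative (metric G r) Phi i j k u
  = third_covariant_derivative (metric G r) Phi j i k u.
Proof.
move=> GT hr flat oW sP Wu Uu; apply/eqP; rewrite -subr_eq0; apply/eqP.
rewrite ricci_identity.
- by rewrite big1 ?oppr0// => l _; rewrite flat ?mul0r.
- by move=> l a b; apply: christoffelC => v c d; exact: metricC.
- by move=> l a b h; exact: derivable_christoffel hr Uu.
- move=> a h; apply: ex_derive; apply: smooth_on_is_derive Wu.
  exact: smooth_on_partial.
- move=> a b h; apply: ex_derive; apply: smooth_on_is_derive Wu.
  by do 2!apply: smooth_on_partial.
- by apply: partial_comm Wu => //; exact: smooth_on_partial.
Qed.

(** The rows of [P] and [Q] form a basis because their joint Gram matrix is block diagonal with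
    invertible blocks. A vector orthogonal to the rows of [Q] is therefore recovered from its
    products with the rows of [P]. *)
Lemma dot_orthogonal_frame {R : realType} {p q : nat} (G : 'M[R]_(p + q))
    (P : 'M[R]_(p, p + q)) (Q : 'M[R]_(q, p + q)) (x y : 'rV[R]_(p + q)) :
  G^T = G -> P *m G *m P^T \in unitmx -> Q *m G *m Q^T \in unitmx ->
  P *m G *m Q^T = 0 -> x *m G *m Q^T = 0 ->
  dot G x y = ((x *m G *m P^T) *m invmx (P *m G *m P^T)
               *m (y *m G *m P^T)^T) 0 0.
Proof.
move=> GT gU muU PQ xQ.
set g := P *m G *m P^T in gU *; set B := col_mx P Q.
have BGB : B *m G *m B^T = block_mx g 0 0 (Q *m G *m Q^T).
  rewrite /B tr_col_mx mul_col_mx mul_col_row PQ.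
  congr block_mx; apply: trmx_inj; rewrite !trmx_mul !trmxK GT mulmxA PQ.
  by rewrite trmx0.
have BGB_unit : B *m G *m B^T \in unitmx.
  by rewrite BGB unitmxE det_ublock unitrM -!unitmxE gU.
have GB_unit : G *m B^T \in unitmx.
  by move: BGB_unit; rewrite -mulmxA unitmx_mul => /andP[].
(* Right multiplication by the invertible [G *m B^T] tests the equality against every vector of the
   frame. *)
have -> : x = (x *m G *m P^T) *m invmx g *m P.
  apply/eqP; rewrite -subr_eq0; apply/eqP.
  apply: (can_inj (mulmxK GB_unit)); rewrite mul0mx mulmxBl !mulmxA.
  rewrite /B tr_col_mx !mul_mx_row xQ -!mulmxA (mulmxA P G Q^T) PQ !mulmx0.
  by rewrite (mulmxA P G P^T) mulVmx// mulmx1 !mulmxA subrr.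
congr (fun_of_matrix _ 0 0).
(* The substitution also hit the [x] on the right-hand side, where the expansion collapses again. *)
have -> : (x *m G *m P^T) *m invmx g *m P *m G *m P^T = x *m G *m P^T.
  by rewrite -!mulmxA (mulmxA P G P^T) mulVmx// mulmx1.
by rewrite /dot !trmx_mul trmxK GT !mulmxA.
Qed.

Lemma second_formC {R : realType} {N M : nat} (G : 'M[R]_M)
    (U : set 'rV[R]_N) (r nu : 'rV[R]_N -> 'rV[R]_M) (u : 'rV[R]_N)
    (i j : 'I_N) :
  open U -> smooth_on U r -> U u ->
  second_form G r nu u i j = second_form G r nu u j i.
Proof. by move=> oU sr Uu; rewrite !mxE (partial_comm_row U). Qed.

(** The Weingarten equation: differentiating the orthogonality of [nu] and [partial a r] moves the
    derivative from one factor to the other, with a sign. *)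
Lemma dot_partial_normal {R : realType} {N M : nat} (G : 'M[R]_M)
    (U : set 'rV[R]_N) (r nu : 'rV[R]_N -> 'rV[R]_M) (u : 'rV[R]_N)
    (a b : 'I_N) :
  open U -> smooth_on U r -> smooth_on U nu ->
  (forall v, U v -> dot G (nu v) (partial a r v) = 0) -> U u ->
  dot G (partial b nu u) (partial a r u) = - second_form G r nu u a b.
Proof.
move=> oU sr snu nr Uu; apply/eqP; rewrite -addr_eq0 mxE; apply/eqP.
apply: (is_derive_constant_on U (fun v => dot G (nu v) (partial a r v)) 0 _ u
  (coord_vec R b)) => //.
apply: is_derive_dot; first exact: smooth_on_is_derive Uu.
by apply: smooth_on_is_derive Uu; exact: smooth_on_partial.
Qed.

Lemma mulmx_dot_row {R : realType} {p q m : nat} (K : 'M[R]_m)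
    (X : 'M[R]_(p, m)) (Y : 'M[R]_(q, m)) (a : 'I_p) (b : 'I_q) :
  (X *m K *m Y^T) a b = dot K (row a X) (row b Y).
Proof. by rewrite /dot -!row_mul !mxE; apply: eq_bigr => k _; rewrite !mxE. Qed.

(* The Ricci equation of a torsionless normal frame: [d_a d_b n_i] is symmetric
   in [a], [b], and [(d_a d_b n_i, n_j) = - (d_b n_i, d_a n_j)], where both
   factors are tangent with components given by the second forms. *)
Lemma second_form_comm {R : realType} {N : nat} (G : 'M[R]_(N + N))
    (U : set 'rV[R]_N) (r : 'rV[R]_N -> 'rV[R]_(N + N))
    (n : 'I_N -> 'rV[R]_N -> 'rV[R]_(N + N)) (u : 'rV[R]_N) (i j : 'I_N) :
  G^T = G -> nonisotropic_submanifold G U r ->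
  constant_gram_normal_basis G U r n -> torsionless G U n -> U u ->
  let om k := second_form G r (n k) u in
  om i *m invmx (metric G r u) *m om j = om j *m invmx (metric G r u) *m om i.
Proof.
move=> GT [oU sr gU] [sn nr [mu muU nn]] tors Uu om.
set g := metric G r u.
have omT k : (om k)^T = om k by apply/matrixP => a b; rewrite mxE (second_formC _ U).
have gT : (invmx g)^T = invmx g.
  by rewrite trmx_inv; congr invmx; apply/matrixP => a b; rewrite mxE metricC.
pose P := \matrix_a partial a r u; pose Q := \matrix_a n a u.
have rP a : row a P = partial a r u by rewrite rowK.
have rQ a : row a Q = n a u by rewrite rowK.
have PP : P *m G *m P^T = g by apply/matrixP => a b; rewrite mulmx_dot_row !rP mxE.
have QQ : Q *m G *m Q^T = mu by apply/matrixP => a b; rewrite mulmx_dot_row !rQ nn.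
have PQ : P *m G *m Q^T = 0.
  by apply/matrixP => a b; rewrite mulmx_dot_row rP rQ dotC// nr// mxE.
have tang k a : partial a (n k) u *m G *m P^T = - row a (om k).
  apply/rowP => b; rewrite mulmx_dot_row rP row_id (dot_partial_normal G U)//.
    by rewrite (second_formC G U)// !mxE.
  by move=> v Uv; exact: nr.
have norm k a : partial a (n k) u *m G *m Q^T = 0.
  by apply/rowP => b; rewrite mulmx_dot_row rQ row_id tors// mxE.
have key a b : dot G (partial b (n i) u) (partial a (n j) u)
    = (om i *m invmx g *m om j) b a.
  rewrite (dot_orthogonal_frame G P Q)// ?PP ?QQ ?gU//.
  rewrite !tang mulNmx linearN mulmxN mulNmx opprK.
  by rewrite -[in RHS](omT j) mulmx_dot_row.
have sym a b : dot G (partial b (n i) u) (partial a (n j) u)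
    = dot G (partial a (n i) u) (partial b (n j) u).
  have D c d : dot G (partial c (partial d (n i)) u) (n j u)
      + dot G (partial d (n i) u) (partial c (n j) u) = 0.
    apply: (is_derive_constant_on U (fun v => dot G (partial d (n i) v) (n j v))
      0 _ u (coord_vec R c)) => //; first by move=> v Uv; exact: tors.
    by apply: is_derive_dot; apply: smooth_on_is_derive Uu => //;
      exact: smooth_on_partial.
  have := D a b; rewrite (partial_comm_row U (n i) a b u oU (sn i) Uu).
  by rewrite -(D b a) => /addrI.
(* All three factors are symmetric, so commutation amounts to symmetry of one matrix product. *)
have -> : om j *m invmx g *m om i = (om i *m invmx g *m om j)^T.
  by rewrite !trmx_mul gT !omT mulmxA.
by apply/matrixP => b a; rewrite [RHS]mxE -!key sym.
Qed.

(** The local potential turns the number of the normal into the outermost covariant derivative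
    index, which flatness lets pass the next one. *)
Lemma second_form_shift {R : realType} {N : nat} (G : 'M[R]_(N + N))
    (U : set 'rV[R]_N) (r : 'rV[R]_N -> 'rV[R]_(N + N))
    (n : 'I_N -> 'rV[R]_N -> 'rV[R]_(N + N)) (u : 'rV[R]_N) (i j k : 'I_N) :
  G^T = G -> potential_submanifold G U r n -> U u ->
  second_form G r (n i) u j k = second_form G r (n j) u i k.
Proof.
move=> GT [hr flat _ _ pot] Uu.
have [W [Phi [oW Wu WU sP E]]] := pot u Uu.
by rewrite !E//; exact: flat_third_covariant_derivativeC hr flat oW sP Wu Uu.
Qed.

(** * The Frobenius algebra of a cubic form *)

(* [(multiplication g om x y)^k = g^{ks} x^i (om_i)_{sj} y^j], for symmetric
   [g] and [om_i]. *)
Definition multiplication {R : realType} {N : nat} (g : 'M[R]_N)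
    (om : 'I_N -> 'M[R]_N) (x y : 'rV[R]_N) : 'rV[R]_N :=
  y *m (\sum_i x 0 i *: om i) *m invmx g.

Section Multiplication.
Context {R : realType} {N : nat} (g : 'M[R]_N) (om : 'I_N -> 'M[R]_N).
Hypotheses (gT : g^T = g) (gU : g \in unitmx).
Hypothesis omC : forall i j k, om i j k = om i k j.
Hypothesis om_shift : forall i j k, om i j k = om j i k.
Hypothesis om_comm : forall i j, om i *m invmx g *m om j = om j *m invmx g *m om i.

Local Notation B x := (\sum_i (x : 'rV[R]_N) 0 i *: om i).

Lemma trmx_cubic_form (x : 'rV[R]_N) : (B x)^T = B x.
Proof.
apply/matrixP => j k; rewrite mxE !summxE; apply: eq_bigr => i _.
by rewrite !mxE omC.
Qed.

(** Both sides are the covector obtained by inserting [x] and [y] into the totally symmetric cubic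
    form. *)
Lemma mulmx_cubic_formC (x y : 'rV[R]_N) : y *m B x = x *m B y.
Proof.
apply/rowP => k; rewrite !mxE.
under eq_bigr do rewrite summxE mulr_sumr.
rewrite exchange_big/=; apply: eq_bigr => i _; rewrite summxE mulr_sumr.
by apply: eq_bigr => j _; rewrite !mxE om_shift; ring.
Qed.

Lemma cubic_form_comm (x y : 'rV[R]_N) :
  B x *m invmx g *m B y = B y *m invmx g *m B x.
Proof.
rewrite mulmx_suml [RHS]mulmx_sumr mulmx_suml; apply: eq_bigr => i _.
rewrite mulmx_sumr [in RHS]mulmx_suml [in RHS]mulmx_suml; apply: eq_bigr => j _.
rewrite -!(scalemxAl, scalemxAr) om_comm !scalerA; congr (_ *: _).
exact: mulrC.
Qed.

Lemma multiplication_frobenius :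
  frobenius_algebra (multiplication g om) (dot g).
Proof.
have BL a x y : B (a *: x + y) = a *: B x + B y.
  rewrite scaler_sumr -big_split; apply: eq_bigr => i _ /=.
  by rewrite !mxE scalerDl scalerA.
have mC : commutative (multiplication g om).
  by move=> x y; rewrite /multiplication mulmx_cubic_formC.
split; [split | split |].
- move=> a x y z; rewrite /multiplication BL mulmxDr mulmxDl.
  by rewrite -scalemxAr -scalemxAl.
- move=> a x y z; rewrite /multiplication mulmxDl mulmxDl.
  by rewrite -!scalemxAl.
- exact: mC.
(* Multiplication operators commute by [cubic_form_comm]. With commutativity, x(yz) = x(zy) = z(xy)
   = (xy)z. *)
- have mCA x y z : multiplication g om x (multiplication g om y z)
      = multiplication g om y (multiplication g om x z).
    rewrite /multiplication; congr (_ *m _).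
    by rewrite -!mulmxA; congr (_ *m _); rewrite !mulmxA cubic_form_comm.
  by move=> x y z; rewrite (mC y) mCA mC.
- by move=> a x y z; rewrite /dot !mulmxDl -!scalemxAl !mxE.
- by move=> x y; exact: dotC.
- move=> x xg; have xg0 : x *m g = 0.
    apply/rowP => k; have := xg (delta_mx 0 k).
    by rewrite /dot trmx_delta -colE !mxE.
  by apply: (can_inj (mulmxK gU)); rewrite xg0 mul0mx.
(* On each side [g] cancels its inverse and leaves the cubic form at [x], [y], [z]. *)
- move=> x y z; rewrite /dot /multiplication !trmx_mul trmx_cubic_form trmx_inv gT.
  by rewrite mulmxKV// mulmx_cubic_formC !mulmxA mulmxK.
Qed.

(** The rows of [J] are an arbitrary frame, and [g'], [om'] are the components of the metric and
    cubic form in it. This covers the given coordinates with [J] the identity and new coordinates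
    with [J] the Jacobian. *)
Lemma multiplication_structure_form (J : 'M[R]_N)
    (f : 'rV[R]_N -> 'rV[R]_N -> R) (e : 'I_N -> 'rV[R]_N) (g' : 'M[R]_N)
    (om' : 'I_N -> 'M[R]_N) :
  J \in unitmx -> (forall i, e i = row i J) -> (forall x y, f x y = dot g x y) ->
  g' = J *m g *m J^T -> (forall i, om' i = J *m B (e i) *m J^T) ->
  frobenius_structure_form (multiplication g om) f e g' om'.
Proof.
move=> JU eJ fg -> om'J.
exists (fun k i j => (invmx (J *m g *m J^T) *m om' i) k j); split.
- by move=> i j; rewrite fg !eJ mulmx_dot_row.
- move=> i j; rewrite /multiplication [in LHS](eJ j).
  have -> : \sum_k (invmx (J *m g *m J^T) *m om' i) k j *: e k
      = row j ((invmx (J *m g *m J^T) *m om' i)^T *m J).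
    by rewrite row_mul mulmx_sum_row; apply: eq_bigr => k _; rewrite !mxE eJ.
  have JTU : J^T \in unitmx by rewrite unitmx_tr.
  (* The inner [J] cancels here; the outer one cancels after transposition against the [J] that
     expands the frame. *)
  have -> : invmx (J *m g *m J^T) *m om' i = invmx J^T *m invmx g *m B (e i) *m J^T.
    rewrite om'J; have JgU : J *m g *m J^T \in unitmx by rewrite !unitmx_mul JU gU JTU.
    apply: (can_inj (mulKmx JgU)); rewrite mulKVmx// !mulmxA.
    by rewrite (mulmxK JTU) (mulmxK gU).
  rewrite -!row_mul !trmx_mul trmx_cubic_form trmx_inv gT trmxK trmx_inv trmxK.
  by rewrite -!mulmxA mulVmx// mulmx1.
- by move=> k i j; rewrite /weingarten [in RHS]mxE opprK.
- by move=> k i j; rewrite mxE.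
Qed.
End Multiplication.

(** * Change of coordinates *)

Lemma derive_partial {R : realType} {N : nat} {W : normedModType R}
    (f : 'rV[R]_N -> W) (u x : 'rV[R]_N) :
  differentiable f u -> 'D_x f u = \sum_i x 0 i *: partial i f u.
Proof.
move=> df; rewrite deriveE// [in LHS](row_sum_delta x) linear_sum.
by apply: eq_bigr => i _; rewrite linearZ /partial deriveE.
Qed.

Lemma first_formE {R : realType} {N M : nat} (G : 'M[R]_M)
    (r : 'rV[R]_N -> 'rV[R]_M) (u x y : 'rV[R]_N) :
  differentiable r u -> first_form G r u x y = dot (metric G r u) x y.
Proof.
move=> dr; rewrite /first_form !derive_partial// dot_suml dotE.
under [RHS]eq_bigr do rewrite mulr_suml.
rewrite exchange_big/=; apply: eq_bigr => i _.
rewrite dot_sumr mulr_sumr; apply: eq_bigr => j _.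
by rewrite !mxE; ring.
Qed.

Lemma derive_comp {R : realType} {V V' W : normedModType R} (f : V -> V')
    (g : V' -> W) (v h : V) :
  differentiable f v -> differentiable g (f v) ->
  'D_h (g \o f) v = 'D_('D_h f v) g (f v).
Proof.
move=> df dg; have dgf := differentiable_comp df dg.
by rewrite (deriveE h dgf) (deriveE h df) (deriveE _ dg) diff_comp.
Qed.

(** The chain rule for [psi \o phi], which is the identity near [v], gives a right inverse of this
    square matrix. *)
Lemma jacobian_unit {R : realType} {N : nat} (V U : set 'rV[R]_N)
    (phi : 'rV[R]_N -> 'rV[R]_N) (v : 'rV[R]_N) :
  coordinate_change V U phi -> V v -> \matrix_i partial i phi v \in unitmx.
Proof.
move=> [oV sphi _ _ [psi spsi psiK]] Vv.
have dphi := smooth_on_differentiable V phi v sphi Vv.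
have dpsi : differentiable psi (phi v).
  by apply: smooth_on_differentiable spsi _; exists v.
suff : (\matrix_i partial i phi v) *m jacobian psi (phi v) = 1%:M.
  by move=> /mulmx1_unit[].
apply/row_matrixP => i; rewrite row_mul rowK -deriveEjacobian// /partial.
rewrite -derive_comp// rowE mulmx1.
rewrite (@near_eq_derive _ _ _ _ id) ?derive_id//.
by apply: filterS (open_nbhs_nbhs (conj oV Vv)) => w /psiK.
Qed.

Section CoordinateChange.
Context {R : realType} {N M : nat} (G : 'M[R]_M) (V U : set 'rV[R]_N)
  (phi : 'rV[R]_N -> 'rV[R]_N) (r : 'rV[R]_N -> 'rV[R]_M).
Hypotheses (sr : smooth_on U r) (cc : coordinate_change V U phi).

Let image_in v : V v -> U (phi v).
Proof. by case: cc => _ _ + _ _ Vv; apply; exists v. Qed.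

Lemma partial_comp_coordinate_change (i : 'I_N) (v : 'rV[R]_N) : V v ->
  partial i (r \o phi) v = \sum_k partial i phi v 0 k *: partial k r (phi v).
Proof.
move=> Vv; case: cc => oV sphi _ _ _.
rewrite -derive_partial; last exact: smooth_on_differentiable sr (image_in v Vv).
rewrite /partial derive_comp//; first exact: smooth_on_differentiable sphi Vv.
exact: smooth_on_differentiable sr (image_in v Vv).
Qed.

Lemma metric_coordinate_change (v : 'rV[R]_N) : V v ->
  let J := \matrix_i partial i phi v in
  metric G (r \o phi) v = J *m metric G r (phi v) *m J^T.
Proof.
move=> Vv J; apply/matrixP => i j; rewrite mulmx_dot_row -first_formE.
  rewrite mxE !rowK /first_form !derive_partial ?partial_comp_coordinate_change//;
  exact: smooth_on_differentiable sr (image_in v Vv).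
exact: smooth_on_differentiable sr (image_in v Vv).
Qed.

Lemma second_form_coordinate_change (n : 'I_N -> 'rV[R]_N -> 'rV[R]_M)
    (i : 'I_N) (v : 'rV[R]_N) :
  (forall k l, dot G (n k (phi v)) (partial l r (phi v)) = 0) -> V v ->
  let J := \matrix_i partial i phi v in
  second_form G (r \o phi) (new_normal phi n i) v
  = J *m (\sum_k partial i phi v 0 k *: second_form G r (n k) (phi v)) *m J^T.
Proof.
move=> nr Vv J; have [oV sphi _ _ _] := cc.
have Uv := image_in v Vv.
(* The second form uses the normal only at [v], so it is frozen there and treated as a constant when
   differentiating. *)
set nu := new_normal phi n i v.
have nur l : dot G nu (partial l r (phi v)) = 0.
  by rewrite dot_suml big1// => k _; rewrite nr mulr0.
apply/matrixP => a b.
have sphia := smooth_on_partial V phi a sphi.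
have drk k : differentiable (partial k r) (phi v).
  by apply: smooth_on_differentiable Uv; exact: smooth_on_partial.
have dphi := smooth_on_differentiable V phi v sphi Vv.
have Da k : is_derive v (coord_vec R b) (fun w => partial a phi w 0 k)
    ('D_(coord_vec R b) (partial a phi) v 0 k).
  by apply: is_derive_coord; exact: smooth_on_is_derive Vv.
have Dr k : is_derive v (coord_vec R b) (fun w => partial k r (phi w))
    (\sum_l partial b phi v 0 l *: partial l (partial k r) (phi v)).
  apply: is_derive_eq (is_derive_diff _ v _ (differentiable_comp dphi (drk k))) _.
  by rewrite derive_comp//; exact: derive_partial.
(* The chain-rule expression for the first derivative of [r \o phi], valid on all of [V], hence fit
   to be differentiated at [v]. *)
pose F w := \sum_k partial a phi w 0 k *: partial k r (phi w).
have DF : is_derive v (coord_vec R b) F (partial b (partial a (r \o phi)) v).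
  apply: (@DeriveDef _ _ _ _ _ _ _).
    apply/derivable_mxP => p q; rewrite /F.
    under eq_fun do rewrite summxE; apply: derivable_fsum => k.
    under eq_fun do rewrite mxE; apply: derivableM; first by have [] := Da k.
    by have [] := is_derive_coord _ _ _ _ p q (Dr k).
  apply: near_eq_derive.
  apply: filterS (open_nbhs_nbhs (conj oV Vv)) => w Vw.
  by rewrite partial_comp_coordinate_change.
have Dc := is_derive_cst nu v (coord_vec R b).
have E1 : second_form G (r \o phi) (new_normal phi n i) v a b
    = 'D_(coord_vec R b) (fun w => dot G nu (F w)) v.
  rewrite mxE; apply/esym/derive_val.
  apply: is_derive_eq (is_derive_dot G _ _ _ _ _ _ Dc DF) _.
  by rewrite /dot !mul0mx mxE add0r.
have E2 : 'D_(coord_vec R b) (fun w => dot G nu (F w)) v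
  = \sum_k partial a phi v 0 k *
     dot G nu (\sum_l partial b phi v 0 l *: partial l (partial k r) (phi v)).
  rewrite /F; under eq_fun do rewrite dot_sumr.
  apply: derive_val; apply: is_derive_fsum => k.
  have H3 := is_derive_dot G _ _ _ _ _ _ Dc (Dr k).
  apply: is_derive_eq (is_derive_mul _ _ _ _ _ _ (Da k) H3) _.
  (* [nur] removes the term with second derivatives of [phi]. *)
  by rewrite nur mulr0 add0r /dot !mul0mx [X in X + _]mxE add0r.
rewrite E1 E2 mulmx_dot_row dotE !rowK.
under [RHS]eq_bigr do rewrite mulr_suml.
rewrite [RHS]exchange_big/=; apply: eq_bigr => k _.
rewrite dot_sumr mulr_sumr; apply: eq_bigr => l _.
rewrite /nu dot_suml summxE mulrCA mulrC; congr (_ * _); congr (_ * _).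
by apply: eq_bigr => m _; rewrite !mxE.
Qed.
End CoordinateChange.

(** * The Frobenius structure on the tangent spaces of a potential submanifold *)

Theorem theorem6p3 (R : realType) (N : nat) (G : 'M[R]_(N + N))
    (U : set 'rV[R]_N) (r : 'rV[R]_N -> 'rV[R]_(N + N))
    (n : 'I_N -> 'rV[R]_N -> 'rV[R]_(N + N))
    (hG : pseudo_euclidean G) (hr : potential_submanifold G U r n) :
  exists mul : 'rV[R]_N -> 'rV[R]_N -> 'rV[R]_N -> 'rV[R]_N,
    [/\ (* a Frobenius algebra on each tangent space *)
        forall u, U u -> frobenius_algebra (mul u) (first_form G r u),
        (* in the given coordinates, if they are flat *)
        forall eta : 'M[R]_N, (forall u, U u -> metric G r u = eta) ->
          forall u, U u ->
            frobenius_structure_form (mul u) (first_form G r u)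
              (@coord_vec R N) eta (fun i => second_form G r (n i) u),
        (* in the given coordinates, flat or not *)
        forall u, U u ->
          frobenius_structure_form (mul u) (first_form G r u)
            (@coord_vec R N) (metric G r u)
            (fun i => second_form G r (n i) u),
        (* in any other flat local coordinates v, where u = phi v *)
        forall (V : set 'rV[R]_N) (phi : 'rV[R]_N -> 'rV[R]_N)
            (eta : 'M[R]_N),
          coordinate_change V U phi ->
          (forall v, V v -> metric G (r \o phi) v = eta) ->
          forall v, V v ->
            frobenius_structure_form (mul (phi v)) (first_form G r (phi v))
              (new_frame phi v) eta
              (fun i => second_form G (r \o phi) (new_normal phi n i) v) &
        (* in any other local coordinates v, where u = phi v *)
        forall (V : set 'rV[R]_N) (phi : 'rV[R]_N -> 'rV[R]_N),
          coordinate_change V U phi ->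
          forall v, V v ->
            frobenius_structure_form (mul (phi v)) (first_form G r (phi v))
              (new_frame phi v) (metric G (r \o phi) v)
              (fun i => second_form G (r \o phi) (new_normal phi n i) v)].
Proof.
have [GT _] := hG.
have [hn flat nb tors _] := hr.
have [oU sr gU] := hn; have [sn nr _] := nb.
pose om u i := second_form G r (n i) u.
have gT u : (metric G r u)^T = metric G r u.
  by apply/matrixP => i j; rewrite mxE metricC.
have omC u i j k : U u -> om u i j k = om u i k j.
  by move=> Uu; exact: second_formC oU sr Uu.
have om_shift u i j k : U u -> om u i j k = om u j i k.
  by move=> Uu; exact: second_form_shift GT hr Uu.
have om_comm u i j : U u ->
    om u i *m invmx (metric G r u) *m om u j = om u j *m invmx (metric G r u) *m om u i.
  by move=> Uu; exact: second_form_comm GT hn nb tors Uu.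
have fE u x y : U u -> first_form G r u x y = dot (metric G r u) x y.
  by move=> Uu; apply: first_formE; exact: smooth_on_differentiable sr Uu.
have given u : U u ->
    frobenius_structure_form (multiplication (metric G r u) (om u))
      (first_form G r u) (@coord_vec R N) (metric G r u) (om u).
  move=> Uu; apply: (@multiplication_structure_form _ _ _ _ _ _ _ 1%:M) => //.
  - exact: gU.
  - by move=> i j k; exact: omC.
  - exact: unitmx1.
  - by move=> i; rewrite rowE mulmx1.
  - by move=> x y; exact: fE.
  - by rewrite trmx1 mulmx1 mul1mx.
  (* Inserting the [i]-th coordinate vector into the cubic form leaves the single summand
     [om u i]. *)
  - move=> i; rewrite trmx1 mulmx1 mul1mx (bigD1 i)//= mxE !eqxx scale1r.
    by rewrite big1 ?addr0// => j ji; rewrite mxE (negPf ji) andbF scale0r.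
have other (V : set 'rV[R]_N) (phi : 'rV[R]_N -> 'rV[R]_N) :
    coordinate_change V U phi -> forall v, V v ->
    frobenius_structure_form (multiplication (metric G r (phi v)) (om (phi v)))
      (first_form G r (phi v)) (new_frame phi v) (metric G (r \o phi) v)
      (fun i => second_form G (r \o phi) (new_normal phi n i) v).
  move=> cc v Vv.
  have Uv : U (phi v) by have [_ _ + _ _] := cc; apply; exists v.
  apply: (@multiplication_structure_form _ _ _ _ _ _ _
    (\matrix_i partial i phi v)) => //.
  - exact: gU.
  - by move=> i j k; exact: omC.
  - exact: (jacobian_unit V U).
  - by move=> i; rewrite rowK.
  - by move=> x y; exact: fE.
  - exact: (metric_coordinate_change G V U).
  - move=> i; apply: (second_form_coordinate_change G V U) => //.
    by move=> k l; exact: nr.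
exists (fun u => multiplication (metric G r u) (om u)); split.
- move=> u Uu; have -> : first_form G r u = dot (metric G r u).
    by apply/funext => x; apply/funext => y; exact: fE.
  apply: multiplication_frobenius => //.
  + exact: gU.
  + by move=> i j k; exact: omC.
  + by move=> i j k; exact: om_shift.
  + by move=> i j; exact: om_comm.
(* Flat coordinates are the case of a constant metric matrix. *)
- by move=> eta geta u Uu; rewrite -(geta u Uu); exact: given.
- exact: given.
- by move=> V phi eta cc geta v Vv; rewrite -(geta v Vv); exact: (other V).
- exact: other.
Qed.
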